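(* Consider (A) the discrete controlled system $$\frac{\partial L^d(q_k,q_{k+1})}{\partial\phi_k}+\frac{\partial L^d(q_{k-1},q_k)}{\partial\phi_k}=0,\qquad \frac{\partial L^d(q_k,q_{k+1})}{\partial s_k}+\frac{\partial L^d(q_{k-1},q_k)}{\partial s_k}=-u_k,$$ with control input $$u_k=-\frac{\gamma\,\Delta\phi_k\,\tau(\phi_{k+1/2})-\gamma\,\Delta\phi_{k-1}\,\tau(\phi_{k-1/2})}{h},$$ and (B) the discrete Euler--Lagrange system of the discrete controlled Lagrangian $L^d_{\tau,\sigma}$, $$\frac{\partial L^d_{\tau,\sigma}(q_k,q_{k+1})}{\partial\phi_k}+\frac{\partial L^d_{\tau,\sigma}(q_{k-1},q_k)}{\partial\phi_k}=0,\qquad \frac{\partial L^d_{\tau,\sigma}(q_k,q_{k+1})}{\partial s_k}+\frac{\partial L^d_{\tau,\sigma}(q_{k-1},q_k)}{\partial s_k}=0.$$ In both systems the second equation is equivalent to conservation of the discrete controlled momentum $p_k$. The dynamics (A) restricted to the momentum level $p_k=p$ is equivalent to the dynamics (B) restricted to the momentum level $p_k=\mu$ if and only if the matching conditions $$\sigma=-\frac{1}{\gamma\kappa},\qquad \mu=\frac{p}{1+\gamma\kappa}$$ hold.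
   Context: The configuration space is the product of a one-dimensional shape space $S$ and a one-dimensional Lie group $G$, with configuration variables $q=(\phi,s)$, $\phi\in S$, $s\in G$. The time step is $h>0$. For a sequence $q_k=(\phi_k,s_k)$ write $q_{k+1/2}=(q_k+q_{k+1})/2$ (componentwise) and $\Delta q_k=q_{k+1}-q_k$. The continuous Lagrangian is kinetic minus potential energy, $$L(\phi,\dot\phi,\dot s)=\tfrac12\big[\alpha\dot\phi^2+2\beta(\phi)\dot\phi\dot s+\gamma\dot s^2\big]-V(\phi),$$ with $\alpha,\gamma$ constants; the potential is $G$-invariant, i.e. depends only on $\phi$. The discrete Lagrangian is $$L^d(q_k,q_{k+1})=h\,L\big(\phi_{k+1/2},\Delta\phi_k/h,\Delta s_k/h\big).$$ With $\tau(\phi)=\kappa\beta(\phi)$ and real constants $\kappa,\sigma$, the discrete controlled Lagrangian is $$L^d_{\tau,\sigma}(q_k,q_{k+1})=h\Big[L\big(\phi_{k+1/2},\tfrac{\Delta\phi_k}{h},\tfrac{\Delta s_k}{h}+\kappa\beta(\phi_{k+1/2})\tfrac{\Delta\phi_k}{h}\big)+\tfrac{\sigma\gamma}{2}\big(\kappa\beta(\phi_{k+1/2})\tfrac{\Delta\phi_k}{h}\big)^2\Big].$$ The discrete controlled momentum is $$p_k=-\frac{\partial}{\partial s_k}L^d_{\tau,\sigma}(q_k,q_{k+1})=\frac{(1+\gamma\kappa)\beta(\phi_{k+1/2})\Delta\phi_k+\gamma\Delta s_k}{h}.$$ The real numbers $p$ and $\mu$ are constant momentum values. The restricted dynamics are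 compared after reduction: the momentum relations $p_k=p$ and $p_k=\mu$ are solved for $\Delta s_k$ and the solutions are substituted in the first equations of (A) and (B), respectively.
   Formalization: ''Only if'' is stated for β not affine (for affine β, μ drops out of the reduced equation and is not forced); equivalence means equal reduced equations for the given V, or equal solutions for every smooth potential; γ, κ, 1+γκ are assumed nonzero. *)

(* Defs.v *)
(* Stdlib real numbers with Coquelicot. *)
From Stdlib Require Import Reals ZArith Lra.
From Coquelicot Require Import Coquelicot.
Open Scope R_scope.

Definition smooth (f : R -> R) : Prop :=
  forall (n : nat) (x : R), ex_derive_n f n x.

Definition affine (f : R -> R) : Prop :=
  exists a b : R, forall x : R, f x = a * x + b.

(* Shape space and group are both described by one global coordinate, so a
   configuration is a pair q = (phi, s) of reals, and midpoints and increments
   are taken in these coordinates. *)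
Definition conf : Type := (R * R)%type.

Definition mid (x y : R) : R := (x + y) / 2.

Definition lagr (alpha gamma : R) (beta V : R -> R) (phi dphi ds : R) : R :=
  1 / 2 * (alpha * dphi ^ 2 + 2 * beta phi * dphi * ds + gamma * ds ^ 2) - V phi.

Definition Ld (h alpha gamma : R) (beta V : R -> R) (q q' : conf) : R :=
  h * lagr alpha gamma beta V (mid (fst q) (fst q'))
        ((fst q' - fst q) / h) ((snd q' - snd q) / h).

Definition tau (kappa : R) (beta : R -> R) (phi : R) : R := kappa * beta phi.

Definition Ld_ctrl (h alpha gamma kappa sigma : R) (beta V : R -> R)
    (q q' : conf) : R :=
  let m := mid (fst q) (fst q') in
  let dphi := (fst q' - fst q) / h in
  let ds := (snd q' - snd q) / h in
  h * (lagr alpha gamma beta V m dphi (ds + tau kappa beta m * dphi)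
       + sigma * gamma / 2 * (tau kappa beta m * dphi) ^ 2).

(* The digit tells which of the two configurations is varied: with
   (q, q') = (q_k, q_{k+1}) the operators D1 differentiate in the variables of
   q_k, and with (q, q') = (q_{k-1}, q_k) the operators D2 do. *)
Definition D1phi (Lag : conf -> conf -> R) (q q' : conf) : R :=
  Derive (fun x => Lag (x, snd q) q') (fst q).
Definition D1s (Lag : conf -> conf -> R) (q q' : conf) : R :=
  Derive (fun x => Lag (fst q, x) q') (snd q).
Definition D2phi (Lag : conf -> conf -> R) (q q' : conf) : R :=
  Derive (fun x => Lag q (x, snd q')) (fst q').
Definition D2s (Lag : conf -> conf -> R) (q q' : conf) : R :=
  Derive (fun x => Lag q (fst q', x)) (snd q').

(* Discrete Euler-Lagrange expressions at q1, the three arguments being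
   q_{k-1}, q_k, q_{k+1}. *)
Definition ELphi (Lag : conf -> conf -> R) (q0 q1 q2 : conf) : R :=
  D1phi Lag q1 q2 + D2phi Lag q0 q1.
Definition ELs (Lag : conf -> conf -> R) (q0 q1 q2 : conf) : R :=
  D1s Lag q1 q2 + D2s Lag q0 q1.

Definition control (h gamma kappa : R) (beta : R -> R) (q0 q1 q2 : conf) : R :=
  - ((gamma * (fst q2 - fst q1) * tau kappa beta (mid (fst q1) (fst q2))
      - gamma * (fst q1 - fst q0) * tau kappa beta (mid (fst q0) (fst q1))) / h).

Definition momentum (h alpha gamma kappa sigma : R) (beta V : R -> R)
    (q q' : conf) : R :=
  - D1s (Ld_ctrl h alpha gamma kappa sigma beta V) q q'.

(* The increment of s between shapes x and y on the momentum level P; see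
   momentum_solved. *)
Definition incr_s (h gamma kappa : R) (beta : R -> R) (P x y : R) : R :=
  (h * P - (1 + gamma * kappa) * beta (mid x y) * (y - x)) / gamma.

Lemma momentumE (h alpha gamma kappa sigma : R) (beta V : R -> R) (q q' : conf) :
  h <> 0 ->
  momentum h alpha gamma kappa sigma beta V q q' =
  ((1 + gamma * kappa) * beta (mid (fst q) (fst q')) * (fst q' - fst q)
   + gamma * (snd q' - snd q)) / h.
Proof.
intros hh; destruct q as [x s], q' as [y t].
unfold momentum, D1s, Ld_ctrl, lagr, tau; simpl fst; simpl snd.
match goal with |- - ?D = ?r => cut (D = - r); [intros ->; ring|] end.
apply is_derive_unique.
auto_derive; [exact I | field; exact hh].
Qed.

Lemma momentum_solved (h alpha gamma kappa sigma : R) (beta V : R -> R)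
    (P : R) (q q' : conf) :
  h <> 0 -> gamma <> 0 ->
  momentum h alpha gamma kappa sigma beta V q q' = P <->
  snd q' - snd q = incr_s h gamma kappa beta P (fst q) (fst q').
Proof.
intros hh hg; rewrite momentumE by exact hh; unfold incr_s; split.
- intros <-; field; split; assumption.
- intros ->; field; split; assumption.
Qed.

(* The phi-equation of Lag with the increments of s eliminated by means of the
   momentum level P.  The discrete Lagrangians depend on s only through its
   increments, so the base point s_k = 0 is immaterial. *)
Definition reduced (h gamma kappa : R) (beta : R -> R)
    (Lag : conf -> conf -> R) (P x y z : R) : R :=
  ELphi Lag (x, - incr_s h gamma kappa beta P x y) (y, 0)
            (z, incr_s h gamma kappa beta P y z).

Definition reducedA (h alpha gamma kappa : R) (beta V : R -> R) (p : R)
    (phi : Z -> R) (k : Z) : R :=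
  reduced h gamma kappa beta (Ld h alpha gamma beta V) p
    (phi (k - 1)%Z) (phi k) (phi (k + 1)%Z).

Definition reducedB (h alpha gamma kappa sigma : R) (beta V : R -> R) (mu : R)
    (phi : Z -> R) (k : Z) : R :=
  reduced h gamma kappa beta (Ld_ctrl h alpha gamma kappa sigma beta V) mu
    (phi (k - 1)%Z) (phi k) (phi (k + 1)%Z).

(* The two reduced equations of motion are the same force balance, for every
   shape sequence, solution or not. *)
Definition same_equations (h alpha gamma kappa sigma : R) (beta V : R -> R)
    (p mu : R) : Prop :=
  forall (phi : Z -> R) (k : Z),
    reducedA h alpha gamma kappa beta V p phi k =
    reducedB h alpha gamma kappa sigma beta V mu phi k.

Definition same_solutions (h alpha gamma kappa sigma : R) (beta V : R -> R)
    (p mu : R) : Prop :=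
  forall (phi : Z -> R) (k : Z),
    reducedA h alpha gamma kappa beta V p phi k = 0 <->
    reducedB h alpha gamma kappa sigma beta V mu phi k = 0.

Definition matching (gamma kappa sigma p mu : R) : Prop :=
  sigma = - (1 / (gamma * kappa)) /\ mu = p / (1 + gamma * kappa).

(* Main.v *)
(* Both discrete Lagrangians are quadratic in the increments d = Delta phi and
   e = Delta s, up to the potential.  Once e is eliminated by means of the
   momentum relations, h times the difference of the two phi-equations is
     (P + K b2 d2) (- b2 + b2' d2 / 2) + (P + K b1 d1) (b1 + b1' d1 / 2)
   with P = h (p - (1 + gamma kappa) mu) / gamma and
   K = - kappa (1 + sigma gamma kappa), and b_i, b_i' the values of beta and
   beta' at the midpoints; matching says P = K = 0.  Conversely, if this
   vanishes identically, then taking x = y and z - y = t gives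
     P (beta (m - t/2) - beta m + beta' m t / 2)
       = K ((beta m)^2 t - beta m beta' m t^2 / 2)
   for all m and t.  Differentiating at t = 0 yields K (beta m)^2 = 0 for all m,
   so K = 0 unless beta = 0, and then P <> 0 would force beta to be affine.
   Equality of the solution sets for all potentials reduces to equality of the
   equations: a linear potential can be chosen for which a given triple of
   shapes solves the first equation. *)

Require Import Defs.
From Stdlib Require Import Reals ZArith Lra.
From Coquelicot Require Import Coquelicot.
Open Scope R_scope.

(** * Smoothness and linear potentials *)

Lemma smooth_ex_derive (f : R -> R) : smooth f -> forall x, ex_derive f x.
Proof. intros hf x; exact (hf 1%nat x). Qed.

Lemma smooth_linear (w : R) : smooth (fun x => w * x).
Proof.
intros n x; apply ex_derive_n_scal_l.
(* Orders 0, 1, 2 and at least 3: the derivative one order lower is the identity, 1 and 0 in the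
   last three cases. *)
destruct n as [|[|[|n]]]; [exact I | apply ex_derive_id | |].
- apply ex_derive_ext with (fun _ => 1); [|apply ex_derive_const].
  intros t; symmetry; apply Derive_id.
- apply ex_derive_ext with (fun _ => 0); [|apply ex_derive_const].
  intros t; symmetry; revert t; induction n as [|n IH]; intros t.
  + simpl; rewrite (Derive_ext _ (fun _ => 1)) by (intros; apply Derive_id).
    apply Derive_const.
  + change (Derive (Derive_n (fun x => x) (S (S n))) t = 0).
    rewrite (Derive_ext _ (fun _ => 0)) by exact IH; apply Derive_const.
Qed.

Lemma Derive_linear (w x : R) : Derive (fun x => w * x) x = w.
Proof. apply is_derive_unique; auto_derive; [exact I | ring]. Qed.

(** * Derivatives of quadratic discrete Lagrangians *)

Lemma ELphi_ext (L L' : conf -> conf -> R) (q0 q1 q2 : conf) :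
  (forall q q', L q q' = L' q q') -> ELphi L q0 q1 q2 = ELphi L' q0 q1 q2.
Proof.
intros H; unfold ELphi, D1phi, D2phi.
f_equal; apply Derive_ext; intros; apply H.
Qed.

Lemma ELs_ext (L L' : conf -> conf -> R) (q0 q1 q2 : conf) :
  (forall q q', L q q' = L' q q') -> ELs L q0 q1 q2 = ELs L' q0 q1 q2.
Proof.
intros H; unfold ELs, D1s, D2s.
f_equal; apply Derive_ext; intros; apply H.
Qed.

(** A common family for [Ld] and [Ld_ctrl], so that each partial derivative is computed only
    once. *)
Definition Lquad (h alpha gamma c A : R) (beta V : R -> R) (q q' : conf) : R :=
  let m := mid (fst q) (fst q') in
  let d := fst q' - fst q in
  let e := snd q' - snd q in
  (alpha * d ^ 2 + 2 * c * beta m * d * e + gamma * e ^ 2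
   + A * beta m ^ 2 * d ^ 2) / (2 * h) - h * V m.

Lemma Ld_quad (h alpha gamma : R) (beta V : R -> R) (q q' : conf) :
  h <> 0 ->
  Ld h alpha gamma beta V q q' = Lquad h alpha gamma 1 0 beta V q q'.
Proof. intros hh; unfold Ld, Lquad, lagr; field; exact hh. Qed.

(** The three summands of [A] come from the coupling term, the square of the shifted velocity and
    the [sigma] term. *)
Lemma Ld_ctrl_quad (h alpha gamma kappa sigma : R) (beta V : R -> R)
    (q q' : conf) :
  h <> 0 ->
  Ld_ctrl h alpha gamma kappa sigma beta V q q' =
  Lquad h alpha gamma (1 + gamma * kappa)
    (2 * kappa + gamma * kappa ^ 2 + sigma * gamma * kappa ^ 2) beta V q q'.
Proof. intros hh; unfold Ld_ctrl, Lquad, lagr, tau; field; exact hh. Qed.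

Section EulerLagrangeQuadratic.

Variables (h alpha gamma c A : R) (beta V : R -> R).
Hypothesis h_neq0 : h <> 0.

Lemma ELs_quad (q0 q1 q2 : conf) :
  ELs (Lquad h alpha gamma c A beta V) q0 q1 q2 =
  - ((c * beta (mid (fst q1) (fst q2)) * (fst q2 - fst q1)
      + gamma * (snd q2 - snd q1)) / h)
  + (c * beta (mid (fst q0) (fst q1)) * (fst q1 - fst q0)
     + gamma * (snd q1 - snd q0)) / h.
Proof.
unfold ELs, D1s, D2s, Lquad; cbn [fst snd].
f_equal; apply is_derive_unique; auto_derive; trivial; field; exact h_neq0.
Qed.

Hypothesis beta_derive : forall x, ex_derive beta x.
Hypothesis V_derive : forall x, ex_derive V x.

(** With [u = beta m * d], the part containing [beta] is [(2 * c * u * e + A * u ^ 2) / (2 * h)].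
    The varied shape enters [m] with weight 1/2 and [d] with sign -1, whence the factor
    [- beta m + Derive beta m * d / 2]. *)
Lemma D1phi_quad (q q' : conf) :
  let m := mid (fst q) (fst q') in
  let d := fst q' - fst q in
  let e := snd q' - snd q in
  D1phi (Lquad h alpha gamma c A beta V) q q' =
  (- alpha * d + (c * e + A * beta m * d) * (- beta m + Derive beta m * d / 2)) / h
  - h * Derive V m / 2.
Proof.
intros m d e; unfold D1phi, Lquad, m, d, e, mid; cbn [fst snd].
apply is_derive_unique; auto_derive.
- repeat split; auto.
- change (fun x => beta x) with beta; change (fun x => V x) with V.
  unfold Rdiv; field; exact h_neq0.
Qed.

Lemma D2phi_quad (q q' : conf) :
  let m := mid (fst q) (fst q') in
  let d := fst q' - fst q in
  let e := snd q' - snd q in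
  D2phi (Lquad h alpha gamma c A beta V) q q' =
  (alpha * d + (c * e + A * beta m * d) * (beta m + Derive beta m * d / 2)) / h
  - h * Derive V m / 2.
Proof.
intros m d e; unfold D2phi, Lquad, m, d, e, mid; cbn [fst snd].
apply is_derive_unique; auto_derive.
- repeat split; auto.
- change (fun x => beta x) with beta; change (fun x => V x) with V.
  unfold Rdiv; field; exact h_neq0.
Qed.

End EulerLagrangeQuadratic.

(** * The obstruction to matching *)

Definition defect (beta : R -> R) (P K x y z : R) : R :=
  (P + K * beta (mid y z) * (z - y))
    * (- beta (mid y z) + Derive beta (mid y z) * (z - y) / 2)
  + (P + K * beta (mid x y) * (y - x))
    * (beta (mid x y) + Derive beta (mid x y) * (y - x) / 2).

Lemma mid_id (x : R) : mid x x = x.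
Proof. unfold mid; field. Qed.

Lemma defect_eq0 (beta : R -> R) (P K : R) :
  (forall x, ex_derive beta x) -> ~ affine beta ->
  (forall x y z, defect beta P K x y z = 0) -> P = 0 /\ K = 0.
Proof.
intros dbeta naff H.
assert (E : forall m t,
  P * (beta (m - t / 2) - beta m + Derive beta m * t / 2)
  - K * beta m ^ 2 * t + K * beta m * Derive beta m * t ^ 2 / 2 = 0).
{ intros m t.
  rewrite <- (H (m - t / 2) (m - t / 2) (m + t / 2)); unfold defect.
  rewrite mid_id; replace (mid (m - t / 2) (m + t / 2)) with m
    by (unfold mid; field).
  field. }
assert (K0 : forall m, K * beta m ^ 2 = 0).
{ intros m.
  assert (D : Derive (fun t =>
    P * (beta (m - t / 2) - beta m + Derive beta m * t / 2)
    - K * beta m ^ 2 * t + K * beta m * Derive beta m * t ^ 2 / 2) 0 = 0).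
  { rewrite (Derive_ext _ (fun _ => 0)) by apply E; apply Derive_const. }
  assert (D' : Derive (fun t =>
    P * (beta (m - t / 2) - beta m + Derive beta m * t / 2)
    - K * beta m ^ 2 * t + K * beta m * Derive beta m * t ^ 2 / 2) 0
    = - (K * beta m ^ 2)).
  (* At [t = 0] the two first-order terms in [P] cancel and the [t ^ 2] term drops out. *)
  { apply is_derive_unique; auto_derive; [auto|].
    change (fun x => beta x) with beta.
    replace (m + - (0 * / 2)) with m by field; field. }
  lra. }
assert (HK : K = 0).
{ destruct (Req_dec K 0) as [|nK]; [assumption|].
  exfalso; apply naff; exists 0, 0; intros x.
  destruct (Rmult_integral _ _ (K0 x)) as [|B]; [contradiction|].
  assert (beta x = 0) by nra; lra. }
split; [|exact HK].
destruct (Req_dec P 0) as [|nP]; [assumption|].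
exfalso; apply naff; exists (Derive beta 0), (beta 0); intros x.
(* With [K = 0], [E] says that [beta] equals its tangent at [m]; here [m = 0], and [t] is chosen so
   that [m - t / 2 = x]. *)
specialize (E 0 (- 2 * x)); rewrite HK in E.
replace (0 - - 2 * x / 2) with x in E by field.
apply (Rmult_eq_reg_l P); [lra | exact nP].
Qed.

(** * Comparison of the reduced equations *)

Section Reduction.

Variables (h alpha gamma kappa sigma : R) (beta : R -> R).
Hypotheses (h_neq0 : h <> 0) (gamma_neq0 : gamma <> 0).

Let mismP (p mu : R) : R := h * (p - (1 + gamma * kappa) * mu) / gamma.
Let mismK : R := - kappa * (1 + sigma * gamma * kappa).

Lemma mismatch_eq0 (p mu : R) :
  kappa <> 0 -> 1 + gamma * kappa <> 0 ->
  matching gamma kappa sigma p mu <-> mismP p mu = 0 /\ mismK = 0.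
Proof.
intros hk hc; unfold matching, mismP, mismK; split.
- intros [-> ->]; split; field; auto.
- intros [HP HK]; split.
  (* The factor is the coefficient of [sigma] in [mismK]. *)
  + apply (Rmult_eq_reg_l (- kappa * (gamma * kappa))).
    * replace (- kappa * (gamma * kappa) * - (1 / (gamma * kappa)))
        with kappa by (field; auto).
      lra.
    * apply Rmult_integral_contrapositive_currified; [lra|].
      apply Rmult_integral_contrapositive_currified; assumption.
  + apply (Rmult_eq_reg_l (1 + gamma * kappa)); [|exact hc].
    replace ((1 + gamma * kappa) * (p / (1 + gamma * kappa))) with p
      by (field; exact hc).
    apply (Rmult_eq_reg_l (h / gamma)).
    * unfold Rdiv in *; lra.
    * unfold Rdiv; apply Rmult_integral_contrapositive_currified;
        [exact h_neq0 | apply Rinv_neq_0_compat; exact gamma_neq0].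
Qed.

Hypothesis beta_derive : forall x, ex_derive beta x.

(** The [alpha] and potential terms cancel. Eliminating [e] makes [c * e + A * beta m * d] affine in
    [beta m * d]; the two systems differ there by [mismP + mismK * beta m * d]. *)
Lemma reduced_sub (V : R -> R) (p mu x y z : R) :
  (forall x, ex_derive V x) ->
  reduced h gamma kappa beta (Ld h alpha gamma beta V) p x y z
  - reduced h gamma kappa beta
      (Ld_ctrl h alpha gamma kappa sigma beta V) mu x y z
  = defect beta (mismP p mu) mismK x y z / h.
Proof.
intros dV; unfold reduced.
rewrite (ELphi_ext _ _ _ _ _ (fun q q' => Ld_quad h alpha gamma beta V q q' h_neq0)).
rewrite (ELphi_ext _ _ _ _ _
  (fun q q' => Ld_ctrl_quad h alpha gamma kappa sigma beta V q q' h_neq0)).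
unfold ELphi; rewrite !D1phi_quad, !D2phi_quad by assumption.
cbn [fst snd]; unfold defect, mismP, mismK, incr_s; field; auto.
Qed.

(** Each of the two midpoints contributes [- h * w / 2], so the slope shifts the equation by a
    constant independent of the shapes. *)
Lemma reduced_linear_potential (p w x y z : R) :
  reduced h gamma kappa beta (Ld h alpha gamma beta (fun v => w * v)) p x y z
  = reduced h gamma kappa beta (Ld h alpha gamma beta (fun v => 0 * v)) p x y z
    - h * w.
Proof.
unfold reduced.
rewrite (ELphi_ext _ _ _ _ _ (fun q q' => Ld_quad h alpha gamma beta _ q q' h_neq0)).
rewrite (ELphi_ext (Ld _ _ _ _ _) _ _ _ _
  (fun q q' => Ld_quad h alpha gamma beta _ q q' h_neq0)).
unfold ELphi.
rewrite !D1phi_quad, !D2phi_quad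
  by first [assumption | intros; auto_derive; exact I].
rewrite !Derive_linear; field; exact h_neq0.
Qed.

Lemma forall_shape_sequence (Q : R -> R -> R -> Prop) :
  (forall (phi : Z -> R) k, Q (phi (k - 1)%Z) (phi k) (phi (k + 1)%Z)) ->
  forall x y z, Q x y z.
Proof.
intros H x y z.
exact (H (fun k => match k with Z0 => y | Zpos _ => z | Zneg _ => x end) 0%Z).
Qed.

Lemma same_equations_defect (V : R -> R) (p mu : R) :
  (forall x, ex_derive V x) ->
  same_equations h alpha gamma kappa sigma beta V p mu <->
  forall x y z, defect beta (mismP p mu) mismK x y z = 0.
Proof.
intros dV; split.
- intros H; apply forall_shape_sequence; intros phi k.
  specialize (H phi k); unfold reducedA, reducedB in H.
  apply (Rmult_eq_reg_r (/ h)); [|apply Rinv_neq_0_compat; exact h_neq0].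
  pose proof (reduced_sub V p mu (phi (k - 1)%Z) (phi k) (phi (k + 1)%Z) dV).
  unfold Rdiv in *; lra.
- intros H phi k; unfold reducedA, reducedB.
  pose proof (reduced_sub V p mu (phi (k - 1)%Z) (phi k) (phi (k + 1)%Z) dV) as E.
  rewrite H in E; unfold Rdiv in E; lra.
Qed.

Lemma same_equations_solutions (V : R -> R) (p mu : R) :
  same_equations h alpha gamma kappa sigma beta V p mu ->
  same_solutions h alpha gamma kappa sigma beta V p mu.
Proof. intros H phi k; rewrite (H phi k); reflexivity. Qed.

Lemma same_solutions_defect (p mu : R) :
  (forall W, smooth W -> same_solutions h alpha gamma kappa sigma beta W p mu) ->
  forall x y z, defect beta (mismP p mu) mismK x y z = 0.
Proof.
intros H; apply forall_shape_sequence; intros phi k.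
(* This slope makes the given shapes solve the first equation at [k], hence also the second; the
   defect, which is independent of the potential, then vanishes. *)
set (w := reducedA h alpha gamma kappa beta (fun v => 0 * v) p phi k / h).
assert (HA : reducedA h alpha gamma kappa beta (fun v => w * v) p phi k = 0).
{ unfold reducedA; rewrite reduced_linear_potential; unfold w, reducedA.
  field; exact h_neq0. }
assert (HB := proj1 (H _ (smooth_linear w) phi k) HA).
pose proof (reduced_sub (fun v => w * v) p mu
  (phi (k - 1)%Z) (phi k) (phi (k + 1)%Z)
  (smooth_ex_derive _ (smooth_linear w))) as E.
unfold reducedA in HA; unfold reducedB in HB; rewrite HA, HB in E.
apply (Rmult_eq_reg_r (/ h)); [|apply Rinv_neq_0_compat; exact h_neq0].
unfold Rdiv in E; lra.
Qed.

End Reduction.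

Theorem theorem1 (h alpha gamma kappa sigma p mu : R) (beta V : R -> R)
    (h_pos : 0 < h) (gamma_neq0 : gamma <> 0) (kappa_neq0 : kappa <> 0)
    (gk_neq0 : 1 + gamma * kappa <> 0)
    (beta_smooth : smooth beta) (V_smooth : smooth V) :
  (forall (q : Z -> conf) (k : Z),
     ELs (Ld h alpha gamma beta V) (q (k - 1)%Z) (q k) (q (k + 1)%Z)
       = - control h gamma kappa beta (q (k - 1)%Z) (q k) (q (k + 1)%Z)
     <->
     momentum h alpha gamma kappa sigma beta V (q k) (q (k + 1)%Z)
       = momentum h alpha gamma kappa sigma beta V (q (k - 1)%Z) (q k))
  /\
  (forall (q : Z -> conf) (k : Z),
     ELs (Ld_ctrl h alpha gamma kappa sigma beta V)
         (q (k - 1)%Z) (q k) (q (k + 1)%Z) = 0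
     <->
     momentum h alpha gamma kappa sigma beta V (q k) (q (k + 1)%Z)
       = momentum h alpha gamma kappa sigma beta V (q (k - 1)%Z) (q k))
  /\
  (matching gamma kappa sigma p mu ->
     same_equations h alpha gamma kappa sigma beta V p mu
     /\ same_solutions h alpha gamma kappa sigma beta V p mu)
  /\
  (~ affine beta ->
     (same_equations h alpha gamma kappa sigma beta V p mu
        <-> matching gamma kappa sigma p mu)
     /\
     ((forall W : R -> R, smooth W ->
         same_solutions h alpha gamma kappa sigma beta W p mu)
        <-> matching gamma kappa sigma p mu)).
Proof.
assert (hh : h <> 0) by lra.
assert (dbeta := smooth_ex_derive _ beta_smooth).
(* Stated for every [W] because the last equivalence ranges over all smooth potentials. *)
assert (match_eqs : forall W, smooth W -> matching gamma kappa sigma p mu ->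
  same_equations h alpha gamma kappa sigma beta W p mu).
{ intros W dW M.
  apply same_equations_defect; try assumption.
  { exact (smooth_ex_derive _ dW). }
  apply mismatch_eq0 with (1 := hh) in M; try assumption.
  destruct M as [-> ->]; intros x y z; unfold defect; ring. }
split; [|split; [|split]].
(* The control raises the coefficient of [beta] from 1 to the [1 + gamma * kappa] of the
   momentum. *)
- intros q k; rewrite !momentumE by exact hh.
  rewrite (ELs_ext _ _ _ _ _ (fun q q' => Ld_quad h alpha gamma beta V q q' hh)).
  rewrite ELs_quad by exact hh; unfold control, tau.
  unfold Rdiv; split; intros E; lra.
- intros q k; rewrite !momentumE by exact hh.
  rewrite (ELs_ext _ _ _ _ _
    (fun q q' => Ld_ctrl_quad h alpha gamma kappa sigma beta V q q' hh)).
  rewrite ELs_quad by exact hh.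
  split; intros E; lra.
- intros M; split; [|apply same_equations_solutions]; auto.
- intros naff; split; split.
  + intros H; apply (mismatch_eq0 h); try assumption.
    apply (defect_eq0 beta); try assumption.
    apply (same_equations_defect h alpha gamma kappa sigma beta hh gamma_neq0
             dbeta V); [exact (smooth_ex_derive _ V_smooth) | exact H].
  + auto.
  + intros H; apply (mismatch_eq0 h); try assumption.
    apply (defect_eq0 beta); try assumption.
    apply (same_solutions_defect h alpha); assumption.
  + intros M W dW; apply same_equations_solutions; auto.
Qed.
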